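(* Let $X$ be a Banach space and let $\tau,\upsilon>0$. Then $$L'_{\mathrm{YJ}}(\tau,\upsilon,X)=\frac{\tau^{2}}{2(\tau^{2}+\upsilon^{2})}\,L^{I}_{\mathrm{YJ}}(\tau,\upsilon,X).$$
   Context: $S_X=\{x\in X:\|x\|=1\}$ is the unit sphere of $X$. Isosceles orthogonality: $x\perp_I y$ means $\|x+y\|=\|x-y\|$. For $\tau,\upsilon>0$ define $$L'_{\mathrm{YJ}}(\tau,\upsilon,X)=\sup\left\{\frac{\|\tau x+\upsilon y\|^2+\|\upsilon x-\tau y\|^2}{2(\tau^2+\upsilon^2)}: x,y\in S_X\right\}$$ and $$L^{I}_{\mathrm{YJ}}(\tau,\upsilon,X)=\sup\left\{\frac{\|(\tau+\upsilon)x+(\tau-\upsilon)y\|^2+\|(\tau-\upsilon)x-(\tau+\upsilon)y\|^2}{\tau^2\|x+y\|^2}: x,y\in X,\ (x,y)\neq(0,0),\ x\perp_I y\right\}.$$ *)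

(* Defs.v *)
From HB Require Import structures.
From mathcomp Require Import all_boot all_order all_algebra.
From mathcomp Require Import all_classical all_reals all_analysis.
Set Implicit Arguments.
Unset Strict Implicit.
Unset Printing Implicit Defensive.
Import Order.TTheory GRing.Theory Num.Theory.
Import numFieldNormedType.Exports.
Local Open Scope classical_set_scope.
Local Open Scope ring_scope.

Definition unit_sphere (R : realType) (X : completeNormedModType R) : set X :=
  [set x | `|x| = 1].
Arguments unit_sphere {R} X.

Definition isosceles_orthogonal (R : realType) (X : completeNormedModType R)
    (x y : X) : Prop :=
  `|x + y| = `|x - y|.

(* By the triangle inequality, the two sets below are bounded above, so [sup]
   is the genuine least upper bound as soon as X is not the zero space; when
   X = 0 both sets are empty and [sup set0 = 0]. *)

Definition LYJ' (R : realType) (tau ups : R) (X : completeNormedModType R) : R :=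
  sup [set (`|tau *: x + ups *: y| ^+ 2 + `|ups *: x - tau *: y| ^+ 2)
             / (2 * (tau ^+ 2 + ups ^+ 2))
      | x in unit_sphere X & y in unit_sphere X].

(* The denominator is nonzero on the index set: if [x + y = 0] and x is
   isosceles orthogonal to y then also [x - y = 0], so [(x, y) = (0, 0)]. *)
Definition LYJ_I (R : realType) (tau ups : R) (X : completeNormedModType R) : R :=
  sup [set (`|(tau + ups) *: p.1 + (tau - ups) *: p.2| ^+ 2
              + `|(tau - ups) *: p.1 - (tau + ups) *: p.2| ^+ 2)
             / (tau ^+ 2 * `|p.1 + p.2| ^+ 2)
      | p in [set p : X * X | p <> (0, 0) /\ isosceles_orthogonal p.1 p.2]].

(* Main.v *)
(* The substitution u = x + y, v = x - y turns isosceles orthogonality into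
   |u| = |v|, and
     (tau + ups) x + (tau - ups) y = tau u + ups v,
     (tau - ups) x - (tau + ups) y = tau v - ups u.
   The quotient defining LYJ_I is invariant under scaling (x, y), so one may
   take |u| = |v| = 1. The two sets of quotients are therefore proportional. *)
Require Import Defs.
From HB Require Import structures.
From mathcomp Require Import all_boot all_order all_algebra.
From mathcomp Require Import all_classical all_reals all_analysis.
From mathcomp Require Import ring.
Import Order.TTheory GRing.Theory Num.Theory.
Import numFieldNormedType.Exports.
Local Open Scope classical_set_scope.
Local Open Scope ring_scope.

Lemma has_sup_scale {R : realType} {c : R} {A : set R} :
  0 < c -> has_sup A -> has_sup [set c * x | x in A].
Proof.
move=> c0 [[a Aa] [M AM]]; split; first by exists (c * a), a.
by exists (c * M) => _ [x Ax <-]; rewrite ler_pM2l //; exact: AM.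
Qed.

Lemma sup_scale_le {R : realType} {c : R} {A : set R} :
  0 < c -> has_sup A -> sup [set c * x | x in A] <= c * sup A.
Proof.
move=> c0 supA; apply: ge_sup; first by case: (has_sup_scale c0 supA).
by move=> _ [x Ax <-]; rewrite ler_pM2l //; exact: sup_upper_bound.
Qed.

Lemma scale_setK {R : realType} {c : R} {A : set R} :
  c != 0 -> [set c^-1 * x | x in [set c * x | x in A]] = A.
Proof.
move=> c0; rewrite image_comp -[RHS]image_id.
by apply: eq_imagel => x _ /=; rewrite mulKf.
Qed.

(* Unconditional, because [sup] is 0 on sets without a supremum. *)
Lemma sup_scale {R : realType} {c : R} {A : set R} :
  0 < c -> sup [set c * x | x in A] = c * sup A.
Proof.
move=> c0; have ci0 : 0 < c^-1 by rewrite invr_gt0.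
have AE := scale_setK (A := A) (lt0r_neq0 c0).
have [supA|supA] := pselect (has_sup A).
  (* The reverse inequality is the same bound, applied to the factor [c^-1] and the scaled set. *)
  apply/eqP; rewrite eq_le sup_scale_le //= -ler_pdivlMl //.
  by rewrite -{1}AE; apply: sup_scale_le => //; exact: has_sup_scale.
(* Both sides are the default 0: scaling back by [c^-1] would carry a supremum of the scaled set
   over to [A]. *)
rewrite (sup_out supA) mulr0 sup_out // => supcA; apply: supA.
by rewrite -AE; exact: has_sup_scale.
Qed.

Section yj_sum.
Context {R : realType} {X : completeNormedModType R}.
Variables tau ups : R.

(** The numerator shared by both constants: [LYJ'] takes it at unit vectors, [LYJ_I] at the pair
    [x + y], [x - y]. *)
Definition yj_sum (u v : X) : R :=
  `|tau *: u + ups *: v| ^+ 2 + `|ups *: u - tau *: v| ^+ 2.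

Lemma yj_sumZ (r : R) (u v : X) :
  yj_sum (r *: u) (r *: v) = r ^+ 2 * yj_sum u v.
Proof.
rewrite /yj_sum !scalerA ![_ * r]mulrC -!scalerA -scalerDr -scalerBr !normrZ.
by rewrite !exprMn real_normK ?num_real // mulrDr.
Qed.

Lemma yj_sum_addsub (x y : X) :
  yj_sum (x + y) (x - y) =
  `|(tau + ups) *: x + (tau - ups) *: y| ^+ 2
    + `|(tau - ups) *: x - (tau + ups) *: y| ^+ 2.
Proof.
rewrite /yj_sum [X in _ + X ^+ 2]distrC.
congr (_ ^+ 2 + _ ^+ 2); congr `|_|.
  by rewrite scalerDr scalerBr addrACA -scalerDl -scalerBl.
by rewrite scalerBr scalerDr opprD addrACA -scalerBl -opprD -scalerDl.
Qed.

End yj_sum.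

Lemma isosceles_addr_neq0 {R : realType} {X : completeNormedModType R}
    {x y : X} :
  (x, y) <> (0, 0) -> isosceles_orthogonal x y -> x + y != 0.
Proof.
move=> xy0 xIy; apply/eqP => xDy; apply: xy0.
have /eqP : `|x - y| = 0 by rewrite -xIy xDy normr0.
rewrite normr_eq0 subr_eq0 => /eqP xE.
move: xDy; rewrite xE -mulr2n -scaler_nat => /eqP.
by rewrite scaler_eq0 pnatr_eq0 /= => /eqP ->.
Qed.

Theorem theorem3p8 (R : realType) (X : completeNormedModType R) (tau ups : R)
    (tau_gt0 : 0 < tau) (ups_gt0 : 0 < ups) :
  LYJ' tau ups X =
    tau ^+ 2 / (2 * (tau ^+ 2 + ups ^+ 2)) * LYJ_I tau ups X.
Proof.
have d_gt0 : 0 < tau ^+ 2 + ups ^+ 2 by rewrite addr_gt0 ?exprn_gt0.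
have [tau0 d0] := (lt0r_neq0 tau_gt0, lt0r_neq0 d_gt0).
rewrite /LYJ' /LYJ_I -sup_scale; last by rewrite divr_gt0 ?mulr_gt0 ?exprn_gt0.
congr sup; apply/seteqP.
split=> [_ [u u1 [v v1 <-]]|_ [_ [[x y] [xy0 xIy] <-] <-]] /=.
  have half (w z : X) : 2^-1 *: (w + z) + 2^-1 *: (w - z) = w.
    rewrite -scalerDr addrACA subrr addr0 -mulr2n -[w *+ 2]scaler_nat scalerA.
    by rewrite mulVf ?pnatr_eq0 // scale1r.
  have halfB (w z : X) : 2^-1 *: (w + z) - 2^-1 *: (w - z) = z.
    by rewrite -scalerN opprB [w + z]addrC half.
  (* The witness pair inverts the substitution: its sum is [u] and its difference [v], so the
     denominator of [LYJ_I] reduces to [tau ^+ 2]. *)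
  exists (yj_sum tau ups u v / tau ^+ 2).
    exists (2^-1 *: (u + v), 2^-1 *: (u - v)) => /=.
      split; last by rewrite /isosceles_orthogonal half halfB u1 v1.
      move=> [uv0 uv0']; move: u1.
      rewrite /unit_sphere /= -(half u v) uv0 uv0' addr0 normr0 => /eqP.
      by rewrite eq_sym oner_eq0.
    by rewrite -yj_sum_addsub half halfB u1 expr1n mulr1.
  rewrite -/(yj_sum tau ups u v).
  by field; rewrite tau0 d0.
have r0 : `|x + y| != 0 by rewrite normr_eq0; exact: isosceles_addr_neq0.
(* Orthogonality gives [x + y] and [x - y] the same norm, so one factor normalises both and comes
   out of [yj_sum] squared, matching the denominator of [LYJ_I]. *)
exists (`|x + y|^-1 *: (x + y)).
  by rewrite /unit_sphere /= normfZV // -normr_eq0.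
exists (`|x + y|^-1 *: (x - y)).
  by rewrite /unit_sphere /= xIy normfZV // -normr_eq0 -xIy.
rewrite -/(yj_sum tau ups _ _) yj_sumZ -yj_sum_addsub.
by field; rewrite tau0 d0 r0.
Qed.
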